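(* Let $K$ be a field and let $v=(|\cdot|,A,\mathfrak m,\kappa)$ be a pseudo-absolute value on $K$. Then there exist a field extension $\widehat K/K$ and a pseudo-absolute value $\widehat v$ on $\widehat K$ extending $v$ such that the extension $\widehat v\mid v$ is complete, i.e. $\widehat K$ is complete with respect to $\widehat v$.
   Context: A pseudo-absolute value on a field $K$ is a map $|\cdot| : K\to[0,+\infty]$ such that (i) $|1|=1$, $|0|=0$; (ii) $|a+b|\le |a|+|b|$; (iii) $|ab|=|a||b|$ whenever $\{|a|,|b|\}\neq\{0,+\infty\}$. The notation $v=(|\cdot|,A,\mathfrak m,\kappa)$ means that $A=\{a\in K:|a|<+\infty\}$ is its finiteness ring (a valuation ring of $K$), $\mathfrak m=\{a\in A:|a|=0\}$ the maximal ideal of $A$ and $\kappa=A/\mathfrak m$ its residue field; $|\cdot|$ induces an absolute value on $\kappa$, the residue absolute value. A field is complete with respect to a pseudo-absolute value on it if the finiteness ring is Henselian and the residue field is complete for the residue absolute value. A pseudo-absolute value on $\widehat K$ extends $v$ if its restriction to $K$ is $v$. *)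

(* Defs.v *)
From HB Require Import structures.
From mathcomp Require Import all_boot all_order all_algebra.
From mathcomp Require Import generic_quotient ring_quotient.
From mathcomp Require Import boolp classical_sets reals ereal topology
  normedtype sequences.

Set Implicit Arguments.
Unset Strict Implicit.
Unset Printing Implicit Defensive.

Import Order.TTheory GRing.Theory Num.Theory.
Import numFieldNormedType.Exports.

Local Open Scope ring_scope.
Local Open Scope classical_set_scope.
Local Open Scope quotient_scope.

Record absval (R : realType) (k : fieldType) := AbsVal {
  av :> k -> R ;
  av_ge0 : forall x, 0 <= av x ;
  av_eq0 : forall x, av x = 0 <-> x = 0 ;
  avM : forall x y, av (x * y) = av x * av y ;
  avD : forall x y, av (x + y) <= av x + av y }.

Definition av_cauchy (R : realType) (k : fieldType) (N : absval R k)
    (u : nat -> k) :=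
  forall e : R, 0 < e ->
    exists n0 : nat, forall m n : nat, (n0 <= m)%N -> (n0 <= n)%N ->
      N (u m - u n) < e.

Definition av_complete (R : realType) (k : fieldType) (N : absval R k) :=
  forall u : nat -> k, av_cauchy N u ->
    exists l : k, (fun n => N (u n - l)) @ \oo --> (0 : R).

(* Meant for a local ring A with residue map pi : A -> k: every simple root in k
   of a monic polynomial over A lifts to a root in A. *)
Definition henselian (A : comNzRingType) (k : fieldType)
    (pi : {rmorphism A -> k}) :=
  forall p : {poly A}, p \is monic ->
  forall a0 : k, root (map_poly pi p) a0 -> ~~ root (map_poly pi p)^`() a0 ->
    exists2 a : A, root p a & pi a = a0.

Record pseudo_absval (R : realType) (K : fieldType) := PseudoAbsVal {
  pav :> K -> \bar R ;
  pav_ge0 : forall a, (0 <= pav a)%E ;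
  pav1 : pav 1 = 1%E ;
  pav0 : pav 0 = 0%E ;
  pavD : forall a b, (pav (a + b) <= pav a + pav b)%E ;
  pavM : forall a b, [set pav a; pav b] <> [set 0%E; +oo%E] ->
           pav (a * b) = (pav a * pav b)%E }.

(* In pavM the value 0 * +oo = 0 of the product on \bar R is never used: the
   hypothesis excludes exactly that case. *)

Section PseudoAbsoluteValue.
Variables (R : realType) (K : fieldType) (v : pseudo_absval R K).

Lemma pavM_cond a b : ~ (v a = 0%E /\ v b = +oo%E) ->
  ~ (v a = +oo%E /\ v b = 0%E) -> v (a * b) = (v a * v b)%E.
Proof.
move=> h1 h2; apply: pavM => e.
have [/= h0|/= h0] : [set v a; v b] 0%E by rewrite e; left.
  have [/= hy|/= hy] : [set v a; v b] +oo%E by rewrite e; right.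
    by move: hy; rewrite -h0.
  by apply: h1.
have [/= hy|/= hy] : [set v a; v b] +oo%E by rewrite e; right.
  by apply: h2.
by move: hy; rewrite -h0.
Qed.

Lemma pavMfin a b : (v a < +oo)%E -> (v b < +oo)%E ->
  v (a * b) = (v a * v b)%E.
Proof.
move=> ha hb; apply: pavM_cond => -[ea eb].
  by rewrite eb ltxx in hb.
by rewrite ea ltxx in ha.
Qed.

Lemma pavN1 : v (- 1) = 1%E.
Proof.
have e : v (-1 * -1) = (v (- 1)%R * v (- 1)%R)%E.
  by apply: pavM_cond => -[->].
move: e; rewrite mulrNN mulr1 pav1; have := pav_ge0 v (-1).
case: (v (-1)) => [r| |] //.
rewrite lee_fin -EFinM => r0 [/esym/eqP]; rewrite -expr2 sqrf_eq1.
case/orP => /eqP er; rewrite ?er //.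
by move: r0; rewrite er oppr_ge0 ler10.
Qed.

Lemma pavN a : v (- a) = v a.
Proof.
rewrite -mulN1r pavM_cond ?pavN1 ?mul1e //.
- by case=> /eqP; rewrite eqe oner_eq0.
- by case.
Qed.

Definition fin_pred : {pred K} := fun a => (v a < +oo)%E.

Lemma fin_pred_subring : subring_closed fin_pred.
Proof.
split=> [|a b|a b]; rewrite !unfold_in /fin_pred.
- by rewrite pav1 ltry.
- move=> ha hb; apply: le_lt_trans (pavD _ _ _) _.
  by rewrite pavN lte_add_pinfty.
- move=> ha hb; rewrite pavMfin //; apply: lte_mul_pinfty => //.
    exact: pav_ge0.
  by rewrite ge0_fin_numE// pav_ge0.
Qed.

HB.instance Definition _ :=
  GRing.isSubringClosed.Build K fin_pred fin_pred_subring.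

Definition finring := {a : K | a \in fin_pred}.

HB.instance Definition _ := SubChoice.on finring.
HB.instance Definition _ := [SubChoice_isSubComNzRing of finring by <:].

Lemma finringP (a : finring) : (v (val a) < +oo)%E.
Proof. exact: (valP a). Qed.

Lemma finring_fineK (a : finring) : (fine (v (val a)))%:E = v (val a).
Proof. by rewrite fineK// ge0_fin_numE ?finringP// pav_ge0. Qed.

Lemma finring_valuation (a : K) : (a \in fin_pred) || (a^-1 \in fin_pred).
Proof.
rewrite !unfold_in /fin_pred; case: (eqVneq a 0) => [->|a0].
  by rewrite pav0 ltry.
rewrite !ltey; apply/negPn/negP; rewrite negb_or !negbK => /andP[/eqP h /eqP h'].
have : v (a * a^-1) = (v a * v a^-1%R)%E.
  by apply: pavM_cond; rewrite h h' => -[].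
by rewrite mulfV// pav1 h h'.
Qed.

Definition fin_ideal : {pred finring} := fun a => v (val a) == 0%E.

Lemma fin_ideal_closed : idealr_closed fin_ideal.
Proof.
split; rewrite ?unfold_in /fin_ideal.
- by rewrite rmorph0 pav0.
- by rewrite rmorph1 pav1 eqe oner_eq0.
- move=> a x y; rewrite !unfold_in => /eqP hx /eqP hy.
  rewrite eq_le pav_ge0 andbT rmorphD rmorphM /=.
  apply: le_trans (pavD _ _ _) _.
  by rewrite pavMfin ?finringP// [v (val x)]hx [v (val y)]hy mule0 adde0.
Qed.

HB.instance Definition _ := isIdealr.Build finring fin_ideal fin_ideal_closed.

Definition residue := {ideal_quot fin_ideal}.

HB.instance Definition _ := GRing.ComNzRing.on residue.

Definition residue_map : finring -> residue := \pi_residue.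

Lemma residue_map_zmod : zmod_morphism residue_map.
Proof. by move=> a b; rewrite /residue_map !piE. Qed.
Lemma residue_map_monoid : monoid_morphism residue_map.
Proof. by split=> [|a b]; rewrite /residue_map !piE. Qed.

HB.instance Definition _ :=
  GRing.isZmodMorphism.Build finring residue residue_map residue_map_zmod.
HB.instance Definition _ :=
  GRing.isMonoidMorphism.Build finring residue residue_map residue_map_monoid.

Lemma residue_map_repr (x : residue) : residue_map (repr x) = x.
Proof. exact: reprK. Qed.

Lemma residue_map_eq a b :
  (residue_map a == residue_map b) = (v (val (a - b)) == 0%E).
Proof. by rewrite /residue_map -Quotient.idealrBE unfold_in. Qed.

Lemma residue_map_eq0 a : (residue_map a == 0) = (v (val a) == 0%E).
Proof. by rewrite -(rmorph0 residue_map) residue_map_eq subr0. Qed.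

Lemma residue_map_pav a b :
  residue_map a = residue_map b -> v (val a) = v (val b).
Proof.
suff le c d : residue_map c = residue_map d -> (v (val c) <= v (val d))%E.
  by move=> e; apply/eqP; rewrite eq_le !le.
move=> /eqP; rewrite residue_map_eq => /eqP h.
rewrite -[c](subrK d) rmorphD; apply: le_trans (pavD _ _ _) _.
by rewrite [v (val (c - d))]h add0e.
Qed.

Definition residue_inv (x : residue) : residue :=
  if x == 0 then 0 else residue_map (insubd 0 (val (repr x))^-1).

Lemma residue_mulVf x : x != 0 -> residue_inv x * x = 1.
Proof.
move=> x0; rewrite /residue_inv (negPf x0).
move: x0; rewrite -{1 3}(residue_map_repr x) residue_map_eq0.
set a := repr x => a0.
have va0 : val a != 0 by apply: contraNneq a0 => ->; rewrite pav0.
have e : (v (val a) * v (val a)^-1%R)%E = 1%E.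
  rewrite -pavM_cond ?mulfV ?pav1// => -[h _]; first by rewrite h eqxx in a0.
  by have := finringP a; rewrite h ltxx.
have fa : (val a)^-1 \in fin_pred.
  rewrite unfold_in /fin_pred ltey; apply/eqP => h.
  move: e; rewrite h gt0_muley //.
  by rewrite lt_neqAle eq_sym a0 pav_ge0.
rewrite -rmorphM -(rmorph1 residue_map); congr residue_map.
by apply: val_inj; rewrite rmorphM /= insubdK// mulVf.
Qed.

Lemma residue_inv0 : residue_inv 0 = 0.
Proof. by rewrite /residue_inv eqxx. Qed.

HB.instance Definition _ :=
  GRing.ComNzRing_isField.Build residue residue_mulVf residue_inv0.

Definition residue_av (x : residue) : R := fine (v (val (repr x))).

Lemma residue_avE a : residue_av (residue_map a) = fine (v (val a)).
Proof. by congr fine; apply: residue_map_pav; rewrite residue_map_repr. Qed.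

Lemma residue_av_ge0 x : 0 <= residue_av x.
Proof. by apply: fine_ge0; apply: pav_ge0. Qed.

Lemma residue_av_eq0 x : residue_av x = 0 <-> x = 0.
Proof.
split=> [|->]; last by rewrite -(rmorph0 residue_map) residue_avE rmorph0 pav0.
rewrite /residue_av => h; apply/eqP.
by rewrite -[x]residue_map_repr residue_map_eq0 -finring_fineK h.
Qed.

Lemma residue_avM x y : residue_av (x * y) = residue_av x * residue_av y.
Proof.
rewrite -[x]residue_map_repr -[y]residue_map_repr -rmorphM !residue_avE rmorphM.
rewrite pavMfin ?finringP// fineM//; by rewrite ge0_fin_numE ?finringP ?pav_ge0.
Qed.

Lemma residue_avD x y : residue_av (x + y) <= residue_av x + residue_av y.
Proof.
rewrite -[x]residue_map_repr -[y]residue_map_repr -rmorphD !residue_avE.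
by rewrite -lee_fin EFinD !finring_fineK rmorphD pavD.
Qed.

Definition residue_absval : absval R residue :=
  AbsVal residue_av_ge0 residue_av_eq0 residue_avM residue_avD.

Definition pav_complete : Prop :=
  henselian residue_map /\ av_complete residue_absval.

End PseudoAbsoluteValue.

Definition pav_extends (R : realType) (K L : fieldType)
    (iota : {rmorphism K -> L}) (v : pseudo_absval R K)
    (w : pseudo_absval R L) :=
  forall a : K, w (iota a) = v a.

(* Main.v *)
Require Import Defs.
From HB Require Import structures.
From mathcomp Require Import all_boot all_order all_algebra fieldext.
From mathcomp Require Import generic_quotient ring_quotient.
From mathcomp Require Import ring lra.
From mathcomp Require Import boolp classical_sets reals ereal filter topology
  normedtype sequences.

(** The field [Khat] is an ultrapower of an algebraic closure of [K]; two facts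
    make it work.

    Extension of pseudo-absolute values ([pav_extension]): a pseudo-absolute
    value on [K] extends to every field [L] containing [K]. Record a would-be
    norm on [L] by the set [S] of pairs (x, r) such that |x| <= r. Such a set is
    a subsemiring of L * R, and the only obstruction to its being consistent is a
    pair (1, r) with r < 1. The pairs coming from [K] form such a system; Zorn's
    lemma gives a maximal one. A maximal system satisfies the dichotomy
    (x, r) in S or (1/x, 1/r) in S ([maximal_dichotomy]): this is Chevalley's
    argument for the existence of valuation rings, with norms carried along. If
    both fail, then 1 is a polynomial in x and also a polynomial in 1/x, each with
    norm less than 1, and each of the two relations can be used to lower the
    degree of the other until none is left. The dichotomy forces |1/x| = 1/|x|,
    hence multiplicativity, for |x| the infimum of the r with (x, r) in S
    ([pav_of_bounds]). Archimedean and ultrametric residue fields are treated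
    alike.

    Completeness for free. If [L] is algebraically closed, every valuation ring of
    [L] is Henselian, because polynomials split and roots of monic polynomials are
    integral ([splits_all_henselian]). For a nonprincipal ultrafilter on nat, the
    limits of |x_k| along the ultrafilter define a pseudo-absolute value on the
    ultrapower of [L] ([ultraprod_pav], again through the dichotomy); the
    ultrapower is still algebraically closed ([ultraprod_splits_all]), and its
    residue field is complete by a diagonal argument
    ([ultrapower_residue_complete]).

    The algebraic closure itself ([algebraic_closure]) is obtained as the field of
    algebraic elements in an ultraproduct of splitting fields, one for each finite
    list of polynomials over [K]. *)

Set Implicit Arguments.
Unset Strict Implicit.
Unset Printing Implicit Defensive.

Import Order.TTheory GRing.Theory Num.Theory.
Import numFieldNormedType.Exports.

Local Open Scope ring_scope.
Local Open Scope classical_set_scope.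

(** * Inverses under a pseudo-absolute value *)

Lemma pav_fin_real (R : realType) (K : fieldType) (v : pseudo_absval R K) a :
  (v a < +oo)%E -> exists2 r, v a = r%:E & 0 <= r.
Proof.
by case: (v a) (pav_ge0 v a) => // r; rewrite lee_fin => r0 _; exists r.
Qed.

Lemma pavV_unit (R : realType) (K : fieldType) (v : pseudo_absval R K) a r :
  v a = r%:E -> 0 < r -> v a^-1 = (r^-1)%:E.
Proof.
move=> va r0; have a0 : a != 0.
  by apply: contraTneq r0 => a0; rewrite -lte_fin -va a0 pav0 ltxx.
have va0 : ~ (v a = 0%E /\ v a^-1 = +oo%E).
  by rewrite va => -[[r00]]; rewrite r00 ltxx in r0.
have va1 : ~ (v a = +oo%E /\ v a^-1 = 0%E) by rewrite va => -[].
have := pavM_cond va0 va1; rewrite mulfV// pav1 va.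
case: (v a^-1) => [s| |] /=.
- rewrite -EFinM => -[/esym rs]; congr EFin.
  by rewrite -[LHS](mulKf (lt0r_neq0 r0)) rs mulr1.
- by rewrite gt0_muley ?lte_fin.
- by rewrite gt0_muleNy ?lte_fin.
Qed.

Lemma pavVy (R : realType) (K : fieldType) (v : pseudo_absval R K) a :
  v a = +oo%E -> v a^-1 = 0%E.
Proof.
move=> va; apply/eqP; apply/negPn/negP => Va0.
have a0 : a != 0 by apply/eqP => a0; move: va; rewrite a0 pav0.
have c1 : ~ (v a = 0%E /\ v a^-1 = +oo%E) by rewrite va => -[].
have c2 : ~ (v a = +oo%E /\ v a^-1 = 0%E).
  by move=> [_ /eqP]; exact/negP.
have := pavM_cond c1 c2; rewrite mulfV// pav1 va gt0_mulye//.
by rewrite lt_neqAle eq_sym Va0 pav_ge0.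
Qed.

Lemma pavV_le (R : realType) (K : fieldType) (v : pseudo_absval R K) a r :
  0 < r -> (r%:E < v a)%E -> (v a^-1%R <= (r^-1)%:E)%E.
Proof.
move=> r0; case va: (v a) => [s| |] // rs.
  have s0 : 0 < s by apply: lt_trans r0 _.
  by rewrite (pavV_unit va s0) lee_fin lef_pV2// ltW.
by rewrite (pavVy va) lee_fin invr_ge0 ltW.
Qed.

Lemma ereal_eq_bounds (R : realType) (x y : \bar R) : (0 <= x)%E -> (0 <= y)%E ->
    (forall r, (x < r%:E)%E -> (y <= r%:E)%E) ->
    (forall r, (y <= r%:E)%E -> (x <= r%:E)%E) ->
  x = y.
Proof.
move=> x0 y0 xy yx; apply/eqP; rewrite eq_le; apply/andP; split.
  by case: y y0 yx {xy} => [s| |] // _ yx; [exact: yx|exact: leey].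
case: x x0 xy {yx} => [s| |] // _ xy; last exact: leey.
by apply/lee_addgt0Pr => e e0; rewrite -EFinD xy// lte_fin ltrDl.
Qed.

(** * Systems of bounds *)

Lemma ex_small_factor (R : realType) (r eps : R) : 0 <= r -> 0 < eps ->
  exists d, [/\ 0 < d, d <= 1 & d * (4 + r) <= eps].
Proof.
move=> r0 eps0; have D0 : 0 < 4 + r by lra.
exists (Num.min 1 (eps / (4 + r))); split.
- by rewrite lt_min ltr01 divr_gt0.
- by rewrite ge_min lexx.
- by rewrite -ler_pdivlMr// ge_min lexx orbT.
Qed.

Section BoundSystems.
Variables (R : realType) (L : fieldType).
Implicit Types (S T : set (L * R)) (z : L * R) (P Q : {poly (L * R)%type}).

Lemma fstX z n : (z ^+ n).1 = z.1 ^+ n.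
Proof. by elim: n => // n IH; rewrite !exprS -IH. Qed.

Lemma sndX z n : (z ^+ n).2 = z.2 ^+ n.
Proof. by elim: n => // n IH; rewrite !exprS -IH. Qed.

(** A pair (x, r) of [S] stands for the bound |x| <= r, so the fields are the
    rules for deriving bounds; [bs_ge1] is the consistency requirement. *)
Record bound_system S : Prop := BoundSystem {
  bs0 : forall r, 0 <= r -> S (0, r) ;
  bs1 : S 1 ;
  bsN1 : S (-1, 1) ;
  bsD : forall y z, S y -> S z -> S (y + z) ;
  bsM : forall y z, S y -> S z -> S (y * z) ;
  bs_ge0 : forall z, S z -> 0 <= z.2 ;
  bs_ge1 : forall r, S (1, r) -> 1 <= r }.

Definition maximal_bounds S := bound_system S /\
  forall T, bound_system T -> S `<=` T -> T `<=` S.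

Lemma ex_maximal_bounds S : bound_system S ->
  exists2 T, maximal_bounds T & S `<=` T.
Proof.
move=> bS; pose P := [set T | bound_system (S `|` T)].
(* Working with unions [S `|` T] makes the empty chain harmless. *)
have [F FP Ftot|T [PT maxT]] := @Zorn_bigcup _ P.
  have [->|/set0P[T0 FT0]] := eqVneq F set0.
    by rewrite /P/= bigcup_set0 setU0.
  have uT T z : F T -> (S `|` T) z -> (S `|` \bigcup_(X in F) X) z.
    by move=> FT [Sz|Tz]; [left|right; exists T].
  have Fu z : (S `|` \bigcup_(X in F) X) z -> exists2 T, F T & (S `|` T) z.
    by move=> [Sz|[T FT Tz]]; [exists T0 => //; left|exists T => //; right].
  have Fu2 y z : (S `|` \bigcup_(X in F) X) y ->
      (S `|` \bigcup_(X in F) X) z ->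
      exists T, [/\ F T, (S `|` T) y & (S `|` T) z].
    move=> /Fu[T FT yT] /Fu[T' FT' zT']; have [TT'|T'T] := Ftot _ _ FT FT'.
      by exists T'; split=> //; exact: setUS yT.
    by exists T; split=> //; exact: setUS zT'.
  split.
  - by move=> r r0; left; exact: bs0.
  - by left; exact: bs1.
  - by left; exact: bsN1.
  - by move=> y z yU /(Fu2 _ _ yU)[T [FT yT zT]]; exact: uT FT (bsD (FP _ FT) yT zT).
  - by move=> y z yU /(Fu2 _ _ yU)[T [FT yT zT]]; exact: uT FT (bsM (FP _ FT) yT zT).
  - by move=> z /Fu[T FT /(bs_ge0 (FP _ FT))].
  - by move=> r /Fu[T FT /(bs_ge1 (FP _ FT))].
exists (S `|` T); last exact: subsetUl.
split=> // U bU SU; apply: contrapT => nU.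
apply: (maxT U); last by rewrite /P/= (setUidr (subset_trans (@subsetUl _ _ _) SU)).
split; first exact: subset_trans (@subsetUr _ _ _) SU.
by move=> UT; apply: nU => z /UT; right.
Qed.

Section Theory.
Variables (S : set (L * R)) (bS : bound_system S).

Lemma bsDp x y r s : S (x, r) -> S (y, s) -> S (x + y, r + s).
Proof. exact: bsD. Qed.

Lemma bsW x r s : S (x, r) -> r <= s -> S (x, s).
Proof.
move=> Sx rs; have s0 : 0 <= s - r by rewrite subr_ge0.
by have := bsDp Sx (bs0 bS s0); rewrite addr0 subrKC.
Qed.

Lemma bsMp x y r s : S (x, r) -> S (y, s) -> S (x * y, r * s).
Proof. exact: bsM. Qed.

Lemma bsN x r : S (x, r) -> S (- x, r).
Proof. by move=> /(bsMp (bsN1 bS)); rewrite mulN1r mul1r. Qed.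

Lemma bsX z n : S z -> S (z ^+ n).
Proof.
by move=> Sz; elim: n => [|n IH]; [exact: bs1|rewrite exprS; exact: bsM].
Qed.

Lemma bs00 : S 0. Proof. exact: (bs0 bS). Qed.

Lemma bs_sum (I : Type) (r : seq I) (p : pred I) (F : I -> L * R) :
  (forall i, p i -> S (F i)) -> S (\sum_(i <- r | p i) F i).
Proof. by move=> SF; apply: big_ind => //; [exact: bs00|exact: bsD]. Qed.

(** The values at [z] of the polynomials with coefficients in [S] form the
    semiring generated by [S] and [z]. *)
Definition coefs_in P := forall i, S P`_i.

Lemma coefs_inM P Q : coefs_in P -> coefs_in Q -> coefs_in (P * Q).
Proof. by move=> SP SQ i; rewrite coefM; apply: bs_sum => j _; apply: bsM. Qed.

Lemma coefs_inD P Q : coefs_in P -> coefs_in Q -> coefs_in (P + Q).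
Proof. by move=> SP SQ i; rewrite coefD; apply: bsD. Qed.

Lemma coefs_inC z : S z -> coefs_in z%:P.
Proof. by move=> Sz i; rewrite coefC; case: eqP => // _; exact: bs00. Qed.

Lemma horner2_ge0 P z : coefs_in P -> 0 <= z.2 -> 0 <= P.[z].2.
Proof.
move=> SP z0; rewrite horner_coef raddf_sum sumr_ge0// => i _.
by apply: mulr_ge0; [exact: bs_ge0 (SP _)|rewrite sndX exprn_ge0].
Qed.

Lemma adjoin_bounds z : 0 <= z.2 ->
    (forall P, coefs_in P -> P.[z].1 = 1 -> 1 <= P.[z].2) ->
  bound_system [set P.[z] | P in coefs_in].
Proof.
move=> z0 Pge1; split.
- by move=> r r0; exists (0, r)%:P; [exact: (coefs_inC (bs0 bS r0))|rewrite hornerC].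
- by exists 1%:P; [exact: (coefs_inC (bs1 bS))|rewrite hornerC].
- by exists (-1, 1)%:P; [exact: (coefs_inC (bsN1 bS))|rewrite hornerC].
- move=> _ _ [P SP <-] [Q SQ <-].
  by exists (P + Q); [exact: coefs_inD|rewrite hornerD].
- move=> _ _ [P SP <-] [Q SQ <-].
  by exists (P * Q); [exact: coefs_inM|rewrite hornerM].
- by move=> _ [P SP <-]; exact: horner2_ge0.
- move=> r [P SP Pz]; have H := Pge1 _ SP. rewrite Pz in H. exact: H.
Qed.

(** A relation is a witness that the bound [z] contradicts [S]: with it, 1 would
    get a bound less than 1. *)
Definition relation z n := exists P,
  [/\ coefs_in P, (size P <= n.+1)%N, P.[z].1 = 1 & P.[z].2 < 1].

Lemma relation0 z : ~ relation z 0%N.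
Proof.
move=> [P [SP /size1_polyC -> ]]; rewrite hornerC => P1 P2.
have := SP 0%N; case: P`_0 P1 P2 => /= x r -> r1 /(bs_ge1 bS).
by rewrite leNgt r1.
Qed.

End Theory.

Section Maximal.
Variables (S : set (L * R)) (mS : maximal_bounds S).
Let bS : bound_system S := mS.1.

Lemma not_in_maximal z : 0 <= z.2 -> ~ S z -> exists n, relation S z n.
Proof.
move=> z0 nSz; apply: contrapT => /forallNP nrel; apply: nSz.
have bT : bound_system [set P.[z] | P in coefs_in S].
  apply: adjoin_bounds => // P SP P1; rewrite leNgt; apply/negP => P2.
  by apply: (nrel (size P)); exists P; split.
apply: (mS.2 _ bT) => [y Sy|].
  by exists y%:P; [exact: coefs_inC|rewrite hornerC].
exists 'X; last by rewrite hornerX.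
by move=> i; rewrite coefX; case: eqP => _; [exact: bs1|exact: bs00].
Qed.

(** A maximal system is closed under limits of bounds and under division by
    elements close to 1: the pairs that, for each positive eps, a factor 1 - e with
    |e| <= eps brings into [S] at a cost of at most eps form a system of bounds
    again. *)
Lemma maximal_approx x r : 0 <= r ->
    (forall eps, 0 < eps ->
       exists2 e, S (e, eps) & S ((1 - e) * x, r + eps)) ->
  S (x, r).
Proof.
pose T : set (L * R) := [set z | 0 <= z.2 /\ forall eps, 0 < eps ->
  exists2 e, S (e, eps) & S ((1 - e) * z.1, z.2 + eps)].
have ST : S `<=` T.
  move=> z Sz; split=> [|eps eps0]; first exact: bs_ge0 Sz.
  exists 0; first exact: (bs0 bS (ltW eps0)).
  rewrite subr0 mul1r; apply: (bsW bS (r := z.2)); first by case: z Sz.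
  by rewrite lerDl ltW.
suff bT : bound_system T by move=> r0 xT; apply: (mS.2 _ bT ST); split.
have S1B e d : S (e, d) -> S (1 - e, 1 + d).
  by move=> Se; apply (bsDp bS (bs1 bS : S (1, 1)) (bsN bS Se)).
(* The product of 1 - e1 and 1 - e2 serves both the sum and the product. *)
have T2 x1 r1 x2 r2 eps : T (x1, r1) -> T (x2, r2) -> 0 < eps ->
    exists d e1 e2, [/\ 0 < d, d <= 1, d * (4 + (r1 + r2)) <= eps &
      [/\ S (e1, d), S (e2, d), S ((1 - e1) * x1, r1 + d),
         S ((1 - e2) * x2, r2 + d) & S (e1 + e2 * (1 - e1), eps)]].
  move=> [/= r10 T1] [/= r20 T2] eps0.
  have [d [d0 d1 dD]] := ex_small_factor (addr_ge0 r10 r20) eps0.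
  have [e1 Se1 Sx1] := T1 _ d0; have [e2 Se2 Sx2] := T2 _ d0.
  exists d, e1, e2; split=> //; split=> //.
  apply: (bsW bS); first by apply (bsDp bS Se1 (bsMp bS Se2 (S1B _ _ Se1))).
  nra.
split.
- by move=> s s0; exact: ST (bs0 bS s0).
- exact: ST (bs1 bS).
- exact: ST (bsN1 bS).
- move=> [x1 r1] [x2 r2] T1 T1'; have [/= r10 _] := T1; have [/= r20 _] := T1'.
  split=> [|eps eps0/=]; first by rewrite /= addr_ge0.
  have [d [e1 [e2 [d0 d1 dD [Se1 Se2 Sx1 Sx2 Se]]]]] := T2 _ _ _ _ _ T1 T1' eps0.
  exists (e1 + e2 * (1 - e1)) => //.
  have -> : (1 - (e1 + e2 * (1 - e1))) * (x1 + x2) =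
     (1 - e2) * ((1 - e1) * x1) + (1 - e1) * ((1 - e2) * x2) by ring.
  apply: (bsW bS).
    by apply (bsDp bS (bsMp bS (S1B _ _ Se2) Sx1) (bsMp bS (S1B _ _ Se1) Sx2)).
  nra.
- move=> [x1 r1] [x2 r2] T1 T1'; have [/= r10 _] := T1; have [/= r20 _] := T1'.
  split=> [|eps eps0/=]; first by rewrite /= mulr_ge0.
  have [d [e1 [e2 [d0 d1 dD [Se1 Se2 Sx1 Sx2 Se]]]]] := T2 _ _ _ _ _ T1 T1' eps0.
  exists (e1 + e2 * (1 - e1)) => //.
  have -> : (1 - (e1 + e2 * (1 - e1))) * (x1 * x2) =
     ((1 - e1) * x1) * ((1 - e2) * x2) by ring.
  apply: (bsW bS); first by apply (bsMp bS Sx1 Sx2).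
  nra.
- by move=> z [].
- move=> s [/= s0 T1]; apply/ler_addgt0Pr => eps eps0.
  have [|e Se] := T1 (eps / 2); first by rewrite divr_gt0.
  rewrite mulr1 => Sx; have := bsDp bS Sx Se.
  by rewrite subrK -addrA -splitr; exact: bs_ge1.
Qed.

(** The bound is that of the geometric series, whose partial sums are
    (1 - c ^+ k) / (1 - c), with c ^+ k as small as desired; [maximal_approx]
    replaces its convergence. *)
Lemma maximal_inv1B c g : S (c, g) -> g < 1 -> S ((1 - c)^-1, (1 - g)^-1).
Proof.
move=> Sc g1; have g0 : 0 <= g := bs_ge0 bS Sc.
have c1 : 1 - c != 0.
  rewrite subr_eq0; apply: contraTneq g1 => c1; rewrite -leNgt.
  by apply: (bs_ge1 bS); rewrite c1.
have Xpair k : (c, g) ^+ k = (c ^+ k, g ^+ k).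
  by rewrite [LHS]surjective_pairing fstX sndX.
apply: maximal_approx => [|eps eps0]; first by rewrite invr_ge0 subr_ge0 ltW.
have [k gk] : exists k, g ^+ k < eps.
  have /cvg_expr : `|g| < 1 by rewrite ger0_norm.
  move=> /cvgrPdist_lt/(_ _ eps0)[k _ /(_ k (leqnn _))].
  by rewrite /= sub0r normrN ger0_norm ?exprn_ge0//; exists k.
exists (c ^+ k).
  by apply: (bsW bS) (ltW gk); rewrite -Xpair; exact: bsX.
have geom (F : fieldType) (a : F) : 1 - a != 0 ->
    (1 - a ^+ k) / (1 - a) = \sum_(i < k) a ^+ i.
  by move=> a1; rewrite -opprB subrX1 -mulNr opprB mulrAC mulfV// mul1r.
rewrite geom//; apply: (bsW bS (r := \sum_(i < k) g ^+ i)).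
  have := @bs_sum _ bS _ (index_enum 'I_k) xpredT (fun i => (c, g) ^+ i).
  have -> : \sum_(i < k) (c, g) ^+ i = (\sum_(i < k) c ^+ i, \sum_(i < k) g ^+ i).
    rewrite [LHS]surjective_pairing !raddf_sum.
    by congr (_, _); apply: eq_bigr => i _; rewrite Xpair.
  by apply=> i _; exact: bsX.
rewrite -geom; last by rewrite subr_eq0 gt_eqF.
apply: ler_wpDr; first exact: ltW.
by rewrite ler_piMl ?invr_ge0 ?gerBl ?exprn_ge0// subr_ge0 ltW.
Qed.

(** Solving the relation for [y] = 1/z for 1 - c, with c its constant term, and
    dividing by 1 - c writes [z ^+ n.+1] as a polynomial in [z] of degree at most
    [n] with norm at most that of [z ^+ n.+1]; substituting it for the leading
    power lowers the degree of the relation for [z]. *)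
Lemma relation_reduce y z m n : y * z = 1 -> 0 <= y.2 -> 0 <= z.2 ->
  (m <= n.+1)%N -> relation S y m -> relation S z n.+1 -> relation S z n.
Proof.
move=> yz y0 z0 mn [C [SC szC C1 C2]] [P [SP szP P1 P2]].
pose tail := \sum_(j < m) C`_j.+1 * y ^+ j.+1.
have Ctail : C.[y] = C`_0 + tail.
  by rewrite (horner_coef_wide _ szC) big_ord_recl expr0 mulr1.
have tail0 : 0 <= tail.2.
  rewrite raddf_sum sumr_ge0// => i _; apply: mulr_ge0; first exact: bs_ge0 (SC _).
  by rewrite sndX exprn_ge0.
have C0 : (C`_0).2 < 1 by apply: le_lt_trans C2; rewrite Ctail lerDl.
have Sd : S ((1 - (C`_0).1)^-1, (1 - (C`_0).2)^-1).
  by apply: maximal_inv1B C0; case: (C`_0) (SC 0%N).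
set d := (_, _) in Sd.
have c1 : 1 - (C`_0).1 != 0.
  rewrite subr_eq0; apply: contraTneq C0 => c1; rewrite -leNgt.
  by apply: (bs_ge1 bS); rewrite c1; case: (C`_0) (SC 0%N).
pose Q := \sum_(j < m) (d * C`_j.+1) *: 'X^(n - j) : {poly (L * R)%type}.
have SQ : coefs_in S Q.
  move=> i; rewrite coef_sum; apply: bs_sum => // j _; rewrite coefZ coefXn.
  apply: bsM => //; first exact: bsM.
  by case: eqP => _; [exact: bs1|exact: bs00].
have szQ : (size Q <= n.+1)%N.
  apply: (leq_trans (size_sum _ _ _)); apply/bigmax_leqP => j _.
  by apply: (leq_trans (size_scale_leq _ _)); rewrite size_polyXn ltnS leq_subr.
have Qz : Q.[z] = d * (z ^+ n.+1 * tail).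
  rewrite horner_sum !mulr_sumr; apply: eq_bigr => j _.
  rewrite hornerZ hornerXn -mulrA; congr (_ * _).
  rewrite mulrCA; congr (_ * _).
  have jn : (j.+1 <= n.+1)%N by apply: leq_trans mn; exact: ltn_ord.
  by rewrite -[in RHS](subnK jn) subSS exprD -mulrA -exprMn [z * y]mulrC yz expr1n mulr1.
have Q1 : Q.[z].1 = (z ^+ n.+1).1.
  have -> : Q.[z].1 = d.1 * ((z ^+ n.+1).1 * tail.1) by rewrite Qz.
  have -> : tail.1 = 1 - (C`_0).1 by rewrite -C1 Ctail [_.1 in RHS]/= addrC addKr.
  by rewrite mulrCA mulVf// mulr1.
have Q2 : Q.[z].2 <= (z ^+ n.+1).2.
  have -> : Q.[z].2 = d.2 * ((z ^+ n.+1).2 * tail.2) by rewrite Qz.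
  rewrite mulrCA ler_piMr ?sndX ?exprn_ge0//.
  rewrite mulrC ler_pdivrMr ?subr_gt0// mul1r lerBrDl.
  by move: C2; rewrite Ctail => /ltW.
have Pz : P.[z] = (take_poly n.+1 P).[z] + P`_n.+1 * z ^+ n.+1.
  rewrite (horner_coef_wide _ szP) big_ord_recr/=; congr (_ + _).
  rewrite (horner_coef_wide _ (size_take_poly _ _)); apply: eq_bigr => i _.
  by rewrite coef_take_poly ltn_ord.
(* [Q] replaces the leading power of [P]. *)
exists (take_poly n.+1 P + P`_n.+1 *: Q); split.
- move=> i; rewrite coefD coefZ; apply: bsD => //; last exact: bsM.
  by rewrite coef_take_poly; case: ifP => _; [exact: SP|exact: bs00].
- rewrite (leq_trans (size_polyD _ _))// geq_max size_take_poly/=.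
  exact: leq_trans (size_scale_leq _ _) szQ.
- rewrite -P1 Pz hornerD hornerZ; congr (_ + _ * _); exact: Q1.
- apply: le_lt_trans P2; rewrite Pz hornerD hornerZ lerD2l.
  by apply: ler_wpM2l Q2; exact: bs_ge0 (SP _).
Qed.

(** Two relations, one for [x] and one for its inverse, would keep lowering the
    larger of their degrees until a relation of degree 0 appears. *)
Lemma maximal_dichotomy x r : x != 0 -> 0 < r ->
  S (x, r) \/ S (x^-1, r^-1).
Proof.
move=> x0 r0; apply: contrapT => /not_orP[nS1 nS2].
have z0 : 0 <= (x, r).2 by exact: ltW.
have y0 : 0 <= (x^-1, r^-1).2 by rewrite invr_ge0 ltW.
have [m rm] := not_in_maximal z0 nS1.
have [n rn] := not_in_maximal y0 nS2.
have zy : (x, r) * (x^-1, r^-1) = 1 by congr (_, _); rewrite mulfV ?gt_eqF.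
move: z0 y0 zy.
move: (x, r) (x^-1, r^-1) rm rn => y z {nS1 nS2}.
have [k] := ubnP (m + n); elim: k => // k IH in m n y z *.
move=> lek rm rn y0 z0 yz.
wlog mn : m n y z rm rn y0 z0 yz lek / (m <= n)%N.
  move=> H; case: (leqP m n) => [mn|/ltnW nm]; first exact: (H m n y z).
  by apply: (H n m z y) => //; rewrite 1?mulrC 1?addnC.
case: n => [|n] in rn mn lek *; first exact: relation0 rn.
apply: (IH m n y z) => //; first by rewrite -ltnS -addnS.
exact: relation_reduce mn rm rn.
Qed.

End Maximal.
End BoundSystems.

(** * The pseudo-absolute value of a system of bounds *)

Section BoundNorm.
Variables (R : realType) (L : fieldType) (S : set (L * R)).
Hypotheses (bS : bound_system S)
  (dichotomy : forall x r, x != 0 -> 0 < r -> S (x, r) \/ S (x^-1, r^-1)).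

Definition bound_norm (x : L) : \bar R :=
  ereal_inf [set r%:E | r in [set r | S (x, r)]].
Local Notation N := bound_norm.

Lemma bound_norm_lt x r : (N x < r%:E)%E -> S (x, r).
Proof. by move=> /ereal_inf_lt[_ [s Sx <-]]; rewrite lte_fin => /ltW; exact: bsW. Qed.

Lemma bound_norm_le x r : S (x, r) -> (N x <= r%:E)%E.
Proof. by move=> Sx; apply: ereal_inf_lbound; exists r. Qed.

Lemma bound_norm_ge0 x : (0 <= N x)%E.
Proof.
by apply: le_ereal_inf_tmp => _ [r Sx <-]; rewrite lee_fin; exact: (bs_ge0 bS Sx).
Qed.

Lemma bound_norm1 : N 1 = 1%E.
Proof.
apply/eqP; rewrite eq_le (bound_norm_le (bs1 bS))/=.
by apply: le_ereal_inf_tmp => _ [r Sx <-]; rewrite lee_fin; exact: (bs_ge1 bS Sx).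
Qed.

Lemma bound_norm0 : N 0 = 0%E.
Proof.
by apply/eqP; rewrite eq_le bound_norm_ge0 andbT; exact: (bound_norm_le (bs0 bS (lexx 0))).
Qed.

Lemma bound_norm_fin x : (N x < +oo)%E ->
  exists2 r, N x = r%:E & 0 <= r /\ forall e, 0 < e -> S (x, r + e).
Proof.
case: (N x) (@bound_norm_lt x) (bound_norm_ge0 x) => // r Nr r0 _.
exists r => //; split=> [|e e0]; first by rewrite lee_fin in r0.
by apply: Nr; rewrite lte_fin ltrDl.
Qed.

Lemma bound_normD x y : (N (x + y) <= N x + N y)%E.
Proof.
have [xy|] := ltP (N x) +oo%E; last first.
  by rewrite leye_eq => /eqP->; rewrite addye ?leey// gt_eqF// (lt_le_trans _ (bound_norm_ge0 _)).
have [yy|] := ltP (N y) +oo%E; last first.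
  by rewrite leye_eq => /eqP->; rewrite addey ?leey// gt_eqF// (lt_le_trans _ (bound_norm_ge0 _)).
have [r -> [r0 Sr]] := bound_norm_fin xy; have [s -> [s0 Ss]] := bound_norm_fin yy.
apply/lee_addgt0Pr => e e0; rewrite -!EFinD; apply: bound_norm_le.
have e2 : 0 < e / 2 by rewrite divr_gt0.
by rewrite [e]splitr addrACA; apply (bsDp bS (Sr _ e2) (Ss _ e2)).
Qed.

Lemma bound_norm_submult x y : (N x < +oo)%E -> (N y < +oo)%E ->
  (N (x * y) <= N x * N y)%E.
Proof.
move=> /bound_norm_fin[r -> [r0 Sr]] /bound_norm_fin[s -> [s0 Ss]].
apply/lee_addgt0Pr => e e0; rewrite -EFinM -EFinD; apply: bound_norm_le.
have [d [d0 d1 dD]] := ex_small_factor (addr_ge0 r0 s0) e0.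
apply: (bsW bS); first by apply (bsMp bS (Sr _ d0) (Ss _ d0)).
nra.
Qed.

Lemma bound_normV_fin x : N x != 0%E -> x != 0 /\ (N x^-1 < +oo)%E.
Proof.
have [->|x0 nx0] := eqVneq x 0; first by rewrite bound_norm0 eqxx.
split=> //; rewrite ltey; apply: contra nx0 => /eqP Vx.
rewrite eq_le bound_norm_ge0 andbT; apply/lee_addgt0Pr => e e0.
rewrite add0e; apply: bound_norm_le; have [//|] := dichotomy x0 e0.
by move=> /bound_norm_le; rewrite Vx.
Qed.

Lemma bound_normV x r : 0 < r -> N x = r%:E -> (N x^-1 <= r^-1%:E)%E.
Proof.
move=> r0 Nx; have [|x0 _] := @bound_normV_fin x.
  by rewrite Nx eqe gt_eqF.
apply/lee_addgt0Pr => e e0; rewrite -EFinD; apply: bound_norm_le.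
have re0 : 0 < r^-1 + e by rewrite addr_gt0 ?invr_gt0.
have x0' : x^-1 != 0 by rewrite invr_eq0.
have [//|] := dichotomy x0' re0.
rewrite invrK => /bound_norm_le; rewrite Nx lee_fin -[_ <= _]lef_pV2 ?posrE ?invr_gt0//.
by rewrite invrK leNgt ltrDl e0.
Qed.

(** If the product had a finite norm, multiplying it by 1/y, whose norm is finite
    since that of [y] is nonzero, would give [x] a finite norm. *)
Lemma bound_normMy x y : N x = +oo%E -> N y != 0%E -> N (x * y) = +oo%E.
Proof.
move=> xy /bound_normV_fin[y0 Vy]; apply/eqP; rewrite -leye_eq leNgt.
apply/negP => fxy; have := bound_norm_submult fxy Vy.
rewrite mulfK// xy leye_eq; apply/negP; rewrite -ltey.
by apply: lte_mul_pinfty => //; [exact: bound_norm_ge0|rewrite ge0_fin_numE ?bound_norm_ge0].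
Qed.

Lemma bound_normM x y : [set N x; N y] <> [set 0%E; +oo%E] ->
  N (x * y) = (N x * N y)%E.
Proof.
move=> nxy.
have [xfin|] := ltP (N x) +oo%E; last first.
  rewrite leye_eq => /eqP xy; have [y0|y0] := eqVneq (N y) 0%E.
    by case: nxy; rewrite xy y0 setUC.
  rewrite bound_normMy// xy gt0_mulye// lt_neqAle eq_sym y0; exact: bound_norm_ge0.
have [yfin|] := ltP (N y) +oo%E; last first.
  rewrite leye_eq => /eqP yy; have [x0|x0] := eqVneq (N x) 0%E.
    by case: nxy; rewrite yy x0.
  rewrite mulrC bound_normMy// yy gt0_muley// lt_neqAle eq_sym x0; exact: bound_norm_ge0.
apply/eqP; rewrite eq_le bound_norm_submult//=.
have [x0|x0] := eqVneq (N x) 0%E; first by rewrite x0 mul0e bound_norm_ge0.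
have [y0|y0] := eqVneq (N y) 0%E; first by rewrite y0 mule0 bound_norm_ge0.
have xyfin : (N (x * y) < +oo)%E.
  apply: le_lt_trans (bound_norm_submult xfin yfin) _.
  by apply: lte_mul_pinfty => //; [exact: bound_norm_ge0|rewrite ge0_fin_numE ?bound_norm_ge0].
(* x = (x * y) / y, and the norm of 1/y is at most the inverse of that of y. *)
have [ny0 Vy] := bound_normV_fin y0; have := bound_norm_submult xyfin Vy.
rewrite mulfK//.
have [s ys [s0 _]] := bound_norm_fin yfin.
have {}s0 : 0 < s by rewrite lt_neqAle s0 andbT eq_sym -eqe -ys.
have := bound_normV s0 ys.
have [t -> [t0 _]] := bound_norm_fin xyfin; have [r -> [r0 _]] := bound_norm_fin xfin.
have [u -> [u0 _]] := bound_norm_fin Vy; rewrite ys -!EFinM !lee_fin => us rtu.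
rewrite -ler_pdivlMr//; apply: le_trans rtu _; exact: ler_wpM2l.
Qed.

(** The infimum of the bounds need not be one of them, whence the strict
    inequality on one side. *)
Lemma pav_of_bounds : exists v : pseudo_absval R L,
  (forall x r, (v x < r%:E)%E -> S (x, r)) /\
  (forall x r, S (x, r) -> (v x <= r%:E)%E).
Proof.
exists (PseudoAbsVal bound_norm_ge0 bound_norm1 bound_norm0 bound_normD bound_normM).
by split; [exact: bound_norm_lt|exact: bound_norm_le].
Qed.

End BoundNorm.

(** A maximal system containing the bounds given by [v] yields a [w] with
    w (iota a) <= v a; the same inequality at 1/a turns it into an equality. *)
Lemma pav_extension (R : realType) (K L : fieldType)
    (iota : {rmorphism K -> L}) (v : pseudo_absval R K) :
  exists w : pseudo_absval R L, pav_extends iota v w.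
Proof.
pose S : set (L * R) :=
  [set z | exists2 a, z.1 = iota a & (v a <= z.2%:E)%E].
have fin a (r : R) : (v a <= r%:E)%E -> (v a < +oo)%E.
  by move=> h; apply: le_lt_trans h (ltry _).
have bS : bound_system S.
  split.
  - by move=> r r0; exists 0; rewrite ?rmorph0// pav0.
  - by exists 1; rewrite ?rmorph1// pav1.
  - by exists (-1); rewrite ?rmorphN1// pavN1.
  - move=> [x r] [y s] [a /= -> ar] [b /= -> bs]; exists (a + b).
      by rewrite rmorphD.
    by apply: le_trans (pavD _ _ _) _; rewrite EFinD leeD.
  - move=> [x r] [y s] [a /= -> ar] [b /= -> bs]; exists (a * b).
      by rewrite rmorphM.
    by rewrite pavMfin ?(fin _ _ ar) ?(fin _ _ bs)// EFinM lee_pmul ?pav_ge0.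
  - by move=> z [a _]; rewrite -lee_fin; apply: le_trans; exact: pav_ge0.
  - move=> r [a /= a1]; rewrite -lee_fin.
    have -> : a = 1 by apply: (fmorph_inj iota); rewrite -a1 rmorph1.
    by rewrite pav1.
have [T mT ST] := ex_maximal_bounds bS.
have [w [_ wT]] := pav_of_bounds mT.1 (maximal_dichotomy mT).
have wv a : (w (iota a) <= v a)%E.
  have [afin|] := ltP (v a) +oo%E; last by rewrite leye_eq => /eqP ->; exact: leey.
  have [r va r0] := pav_fin_real afin; rewrite va; apply/wT/ST.
  by exists a; rewrite // va.
exists w => a; apply/eqP; rewrite eq_le wv/= leNgt; apply/negP => wva.
have a0 : a != 0.
  by apply: contraTneq wva => ->; rewrite pav0 ltNge pav_ge0.
have w1 : (w (iota (a^-1)%R) < +oo)%E -> (w (iota a) * w (iota (a^-1)%R) = 1)%E.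
  move=> h; rewrite -pavMfin// ?(lt_le_trans wva (leey _))//.
  by rewrite -rmorphM mulfV// rmorph1 pav1.
have [afin|] := ltP (v a) +oo%E; last first.
  rewrite leye_eq => /eqP va; have := wv a^-1; rewrite (pavVy va) => wVa.
  have {}wVa : w (iota a^-1) = 0%E by apply/eqP; rewrite eq_le wVa pav_ge0.
  by move: w1; rewrite wVa mule0 ltry => /(_ isT)/eqP; rewrite eqe eq_sym oner_eq0.
have [r va r0] := pav_fin_real afin.
have [s wa s0] := pav_fin_real (lt_trans wva afin).
rewrite va wa lte_fin in wva; have {}r0 := le_lt_trans s0 wva.
have := wv a^-1; rewrite (pavV_unit va r0) => wVa.
have [t wVa' t0] := pav_fin_real (le_lt_trans wVa (ltry _)).
rewrite wVa' lee_fin in wVa; move: w1; rewrite wVa' ltry wa -EFinM => /(_ isT)[].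
apply/eqP; rewrite lt_eqF//; apply: le_lt_trans (ler_wpM2l s0 wVa) _.
by rewrite ltr_pdivrMr// mul1r.
Qed.

(** * Ultraproducts of fields *)

Definition splits_completely (F : fieldType) (p : {poly F}) :=
  exists rs : seq F, p = \prod_(a <- rs) ('X - a%:P).

Definition splits_all (F : fieldType) :=
  forall p : {poly F}, p \is monic -> splits_completely p.

Lemma map_poly_prod_XsubC (A B : comNzRingType) (f : {rmorphism A -> B})
    (s : seq A) :
  map_poly f (\prod_(a <- s) ('X - a%:P)) = \prod_(b <- map f s) ('X - b%:P).
Proof. by rewrite map_prod_XsubC big_map. Qed.

Lemma seq_preimage (T : Type) (S : eqType) (f : T -> S) (s : seq S) :
  (forall x, x \in s -> exists y, x = f y) -> exists t, s = map f t.
Proof.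
elim: s => [|x s IH] xs; first by exists [::].
have [y ->] := xs x (mem_head _ _).
have [|t ->] := IH; last by exists (y :: t).
by move=> z zs; apply: xs; rewrite inE zs orbT.
Qed.

Section Ultraproduct.
Variables (I : Type) (U : set_system I) (UU : UltraFilter U) (K : I -> fieldType).
Local Open Scope quotient_scope.

(** The ultrafilter appears as a parameter because it makes the index type
    inhabited, so that the product is a nonzero ring. *)
Definition family_prod (_ : UltraFilter U) := forall i, K i.
Local Notation P := (family_prod UU).

HB.instance Definition _ := gen_eqMixin P.
HB.instance Definition _ := gen_choiceMixin P.

Definition fp_zero : P := fun i => 0.
Definition fp_one : P := fun i => 1.
Definition fp_opp (f : P) : P := fun i => - f i.
Definition fp_add (f g : P) : P := fun i => f i + g i.
Definition fp_mul (f g : P) : P := fun i => f i * g i.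

Lemma fp_addA : associative fp_add.
Proof. by move=> f g h; apply: functional_extensionality_dep => i; exact: addrA. Qed.
Lemma fp_addC : commutative fp_add.
Proof. by move=> f g; apply: functional_extensionality_dep => i; exact: addrC. Qed.
Lemma fp_add0 : left_id fp_zero fp_add.
Proof. by move=> f; apply: functional_extensionality_dep => i; exact: add0r. Qed.
Lemma fp_addN : left_inverse fp_zero fp_opp fp_add.
Proof. by move=> f; apply: functional_extensionality_dep => i; exact: addNr. Qed.

HB.instance Definition _ := GRing.isZmodule.Build P fp_addA fp_addC fp_add0 fp_addN.

Lemma fp_mulA : associative fp_mul.
Proof. by move=> f g h; apply: functional_extensionality_dep => i; exact: mulrA. Qed.
Lemma fp_mulC : commutative fp_mul.
Proof. by move=> f g; apply: functional_extensionality_dep => i; exact: mulrC. Qed.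
Lemma fp_mul1 : left_id fp_one fp_mul.
Proof. by move=> f; apply: functional_extensionality_dep => i; exact: mul1r. Qed.
Lemma fp_mulD : left_distributive fp_mul fp_add.
Proof. by move=> f g h; apply: functional_extensionality_dep => i; exact: mulrDl. Qed.
Lemma fp_one_neq0 : fp_one != 0.
Proof.
apply/eqP => e; have [i _] := @filter_ex _ U _ _ filterT.
by have /eqP := congr1 (fun f : P => f i) e; rewrite oner_eq0.
Qed.

HB.instance Definition _ := GRing.Zmodule_isComNzRing.Build P
  fp_mulA fp_mulC fp_mul1 fp_mulD fp_one_neq0.

Definition fp_proj (i : I) (f : P) : K i := f i.

HB.instance Definition _ i :=
  GRing.isZmodMorphism.Build P (K i) (@fp_proj i) (fun _ _ => erefl).
HB.instance Definition _ i := GRing.isMonoidMorphism.Build P (K i) (@fp_proj i)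
  (conj erefl (fun _ _ => erefl)).

Definition almost_zero : {pred P} := fun f => `[< U [set i | f i = 0] >].

Lemma almost_zero_ideal : idealr_closed almost_zero.
Proof.
split; rewrite ?unfold_in.
- by apply/asboolP; apply: filterE.
- apply/asboolP => U0; have [i /eqP] := filter_ex U0.
  by rewrite [X in X == _]/= oner_eq0.
- move=> a f g; rewrite !unfold_in => /asboolP Uf /asboolP Ug.
  apply/asboolP; apply: filterS2 Uf Ug => i /= fi gi.
  by rewrite -[LHS]/(a i * f i + g i) fi gi mulr0 addr0.
Qed.

HB.instance Definition _ := isIdealr.Build P almost_zero almost_zero_ideal.

Definition ultraprod := {ideal_quot almost_zero}.

HB.instance Definition _ := GRing.ComNzRing.on ultraprod.

Definition up_class : P -> ultraprod := \pi_ultraprod.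

Lemma up_class_zmod : zmod_morphism up_class.
Proof. by move=> a b; rewrite /up_class !piE. Qed.
Lemma up_class_monoid : monoid_morphism up_class.
Proof. by split=> [|a b]; rewrite /up_class !piE. Qed.

HB.instance Definition _ :=
  GRing.isZmodMorphism.Build P ultraprod up_class up_class_zmod.
HB.instance Definition _ :=
  GRing.isMonoidMorphism.Build P ultraprod up_class up_class_monoid.

Lemma up_class_repr (x : ultraprod) : up_class (repr x) = x.
Proof. exact: reprK. Qed.

Lemma up_class_eq f g : up_class f = up_class g <-> U [set i | f i = g i].
Proof.
transitivity (up_class f == up_class g); first by split=> /eqP.
rewrite /up_class -Quotient.idealrBE unfold_in; split => [/asboolP|] Ufg.
  by apply: filterS Ufg => i /= /subr0_eq.
apply/asboolP; apply: filterS Ufg => i /= fg; apply/eqP.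
by rewrite -[X in X == _]/(f i - g i) fg subrr.
Qed.

Definition up_inv (x : ultraprod) : ultraprod :=
  up_class (fun i => (repr x i)^-1).

Lemma up_mulVf x : x != 0 -> up_inv x * x = 1.
Proof.
move=> /eqP x0; rewrite /up_inv -{2}[x]up_class_repr -rmorphM -(rmorph1 up_class).
apply/up_class_eq; have [Ux|] := in_ultra_setVsetC [set i | repr x i = 0] UU.
  by case: x0; rewrite -[x]up_class_repr -(rmorph0 up_class); apply/up_class_eq.
by apply: filterS => i /= /eqP xi; exact: mulVf.
Qed.

Lemma up_inv0 : up_inv 0 = 0.
Proof.
have U0 : U [set i | repr (0 : ultraprod) i = 0].
  by apply/(up_class_eq _ 0); rewrite up_class_repr rmorph0.
rewrite -[RHS](rmorph0 up_class); apply/up_class_eq; apply: filterS U0 => i ri.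
by apply: etrans (invr0 _); congr (_^-1).
Qed.

HB.instance Definition _ :=
  GRing.ComNzRing_isField.Build ultraprod up_mulVf up_inv0.

(** A monic polynomial has the same degree in every component, so that the roots
    found in the components can be listed in sequences of the same length and
    assembled rank by rank. *)
Lemma ultraprod_split (f : {poly P}) : f \is monic ->
    U [set i | splits_completely (map_poly (fp_proj i) f)] ->
  splits_completely (map_poly up_class f).
Proof.
move=> f_monic Uf.
have [rs rsP] : exists rs : forall i, seq (K i),
    U [set i | map_poly (fp_proj i) f = \prod_(a <- rs i) ('X - a%:P)].
  exists (fun i => if pselect (splits_completely (map_poly (fp_proj i) f))
    is left h then sval (cid h) else [::]).
  by apply: filterS Uf => i /= si; case: pselect => // h; exact: (svalP (cid h)).
pose n := (size f).-1.
pose r j : P := fun i => (rs i)`_j.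
exists (map up_class (mkseq r n)).
rewrite -map_poly_prod_XsubC; apply/polyP => k; rewrite !coef_map; apply/up_class_eq.
apply: filterS rsP => i /= fi.
rewrite -[LHS]/(fp_proj i _) -[RHS]/(fp_proj i _) -!coef_map fi map_poly_prod_XsubC.
have -> // : map (fp_proj i) (mkseq r n) = rs i.
have -> : n = size (rs i).
  rewrite /n -(@size_map_poly_id0 _ _ (fp_proj i) f) ?fi ?size_prod_XsubC//.
  by rewrite (monicP f_monic) rmorph1 oner_neq0.
by rewrite -map_comp; exact: mkseq_nth.
Qed.

Section Diagonal.
Variables (F : fieldType) (h : forall i, {rmorphism F -> K i}).

Definition fp_diag (a : F) : P := fun i => h i a.

Lemma fp_diag_zmod : zmod_morphism fp_diag.
Proof.
by move=> a b; apply: functional_extensionality_dep => i; exact: rmorphB.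
Qed.
Lemma fp_diag_monoid : monoid_morphism fp_diag.
Proof.
split=> [|a b]; apply: functional_extensionality_dep => i.
  exact: rmorph1.
exact: rmorphM.
Qed.

HB.instance Definition _ := GRing.isZmodMorphism.Build F P fp_diag fp_diag_zmod.
HB.instance Definition _ :=
  GRing.isMonoidMorphism.Build F P fp_diag fp_diag_monoid.

Definition up_diag : {rmorphism F -> ultraprod} := up_class \o fp_diag.

Lemma ultraprod_diag_split (p : {poly F}) : p \is monic ->
    U [set i | splits_completely (map_poly (h i) p)] ->
  splits_completely (map_poly up_diag p).
Proof.
move=> p_monic Up; rewrite map_poly_comp; apply: ultraprod_split.
  exact: monic_map.
by apply: filterS Up => i /=; rewrite -map_poly_comp.
Qed.

End Diagonal.

Lemma ultraprod_splits_all :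
  (forall i, splits_all (K i)) -> splits_all ultraprod.
Proof.
move=> Kall q q_monic; pose n := (size q).-1.
pose low : {poly P} := \poly_(i < n) repr (q`_i).
pose f := 'X^n + low.
have szf : (size low < size ('X^n : {poly P}))%N.
  by rewrite size_polyXn ltnS size_poly.
have f_monic : f \is monic.
  by rewrite monicE lead_coefDl// lead_coefXn.
have <- : map_poly up_class f = q.
  apply/polyP => k; rewrite coef_map coefD coefXn coef_poly.
  case: ltngtP => [kn|nk|->].
  - by rewrite add0r; exact: up_class_repr.
  - rewrite addr0 raddf0 nth_default// (leq_trans _ nk)//.
    by rewrite polySpred ?monic_neq0.
  - by rewrite addr0 -/(lead_coef q) (monicP q_monic); exact: rmorph1 up_class.
apply: ultraprod_split => //; apply: filterE => i.
by apply: Kall; exact: monic_map.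
Qed.

End Ultraproduct.

(** * Algebraic closure *)

(** A root of an irreducible factor. *)
Lemma root_extension (F : fieldType) (p : {poly F}) : (1 < size p)%N ->
  exists (E : fieldType) (iota : {rmorphism F -> E}) (x : E),
    root (map_poly iota p) x.
Proof.
have [n] := ubnP (size p); elim: n p => // n IH p szp p1.
have [irr|nirr] := pselect (irreducible_poly p).
  by have [L _ [z pz _]] := irredp_FAdjoin irr; exists L, (in_alg L), z.
have p0 : p != 0 by rewrite -size_poly_gt0 (ltn_trans _ p1).
have [q [sq qp nqp]] : exists q : {poly F}, [/\ size q != 1%N, q %| p & ~~ (q %= p)].
  apply: contrapT => nq; apply: nirr; split=> // q sq qp.
  by apply/negPn/negP => nqp; apply: nq; exists q.
have q0 : q != 0 by apply: contraTneq qp => ->; rewrite dvd0p.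
have q1 : (1 < size q)%N by rewrite ltn_neqAle eq_sym sq size_poly_gt0.
have szqp : (size q < size p)%N.
  by rewrite ltn_neqAle dvdp_leq// andbT dvdp_size_eqp.
have [|//|E [iota [x qx]]] := IH q; first by rewrite (leq_trans szqp).
by exists E, iota, x; have /dvdpP[k ->] := qp; rewrite rmorphM rootM qx orbT.
Qed.

Lemma split_extension (F : fieldType) (p : {poly F}) : p \is monic ->
  exists (E : fieldType) (iota : {rmorphism F -> E}),
    splits_completely (map_poly iota p).
Proof.
have [n] := ubnP (size p); elim: n F p => // n IH F p szp p_monic.
have [p1|p1] := leqP (size p) 1%N.
  exists F, idfun, [::]; rewrite big_nil map_poly_id//.
  by have /size1_polyC pC := p1; move: p_monic; rewrite pC monicE lead_coefC => /eqP ->.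
have [E [iota [x /factor_theorem[q pq]]]] := root_extension p1.
have q_monic : q \is monic.
  by rewrite -(monicMr _ (monicXsubC x)) -pq monic_map.
have [|//|E' [jota [rs qrs]]] := IH E q.
  move: szp; rewrite ltnS -(size_map_poly iota p) pq.
  by rewrite size_Mmonic ?monicXsubC ?monic_neq0// size_XsubC addn2.
exists E', (jota \o iota), (jota x :: rs).
by rewrite map_poly_comp /= pq rmorphM /= qrs big_cons rmorphB /= map_polyX map_polyC mulrC.
Qed.

Lemma split_seq_extension (F : fieldType) (s : seq {poly F}) :
  exists (E : fieldType) (iota : {rmorphism F -> E}),
    forall p, p \in s -> p \is monic -> splits_completely (map_poly iota p).
Proof.
elim: s => [|p s [E [iota sE]]]; first by exists F, idfun.
have [p_monic|np] := boolP (p \is monic); last first.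
  exists E, iota => q; rewrite inE => /predU1P[->|]; [by rewrite (negPf np)|exact: sE].
have [E' [jota pE']] := split_extension (monic_map iota p_monic).
exists E', (jota \o iota) => q; rewrite map_poly_comp inE => /predU1P[-> _ //|qs q_monic].
have [rs ->] := sE q qs q_monic; exists (map jota rs).
exact: map_poly_prod_XsubC.
Qed.

(** The cones of lists containing a given finite list generate a proper filter.
    For an ultrafilter containing it, each polynomial belongs to almost all lists,
    hence splits in almost all components and therefore in the ultraproduct. *)
Lemma split_all_extension (F : fieldType) :
  exists (E : fieldType) (iota : {rmorphism F -> E}),
    forall p, p \is monic -> splits_completely (map_poly iota p).
Proof.
pose I := seq {poly F}.
pose cones : set_system I := [set A | exists s0 : I, forall s : I,
  {subset s0 <= s} -> A s].
have cones_proper : ProperFilter cones.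
  split; first by move=> [s /(_ s)]; apply.
  split.
  - by exists [::].
  - move=> A B [s1 A1] [s2 B2]; exists (s1 ++ s2) => s ss; split.
      by apply: A1 => p ps; apply: ss; rewrite mem_cat ps.
    by apply: B2 => p ps; apply: ss; rewrite mem_cat ps orbT.
  - by move=> A B AB [s0 A0]; exists s0 => s /A0; exact: AB.
have [U [UU conesU]] := ultraFilterLemma cones_proper.
have h (s : seq {poly F}) : {E : fieldType & {iota : {rmorphism F -> E} |
    forall p, p \in s -> p \is monic -> splits_completely (map_poly iota p)}}.
  by have [E /cid[iota ?]] := cid (split_seq_extension s); exists E, iota.
exists (ultraprod UU (fun s => projT1 (h s))), (up_diag UU (fun s => sval (projT2 (h s)))).
move=> p p_monic; apply: ultraprod_diag_split => //; apply: conesU.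
by exists [:: p] => s ps /=; apply: (svalP (projT2 (h s))) => //; apply: ps; rewrite inE.
Qed.

Section AlgebraicElements.
Variables (F E : fieldType) (iota : {rmorphism F -> E}).

Definition algebraic_pred : {pred E} := fun x => `[< algebraicOver iota x >].

Lemma algebraic_pred_divring : divring_closed algebraic_pred.
Proof.
split=> [|x y /asboolP ax /asboolP ay|x y /asboolP ax /asboolP ay]; apply/asboolP.
- exact: algebraic1.
- exact: algebraic_sub.
- exact: algebraic_div.
Qed.

HB.instance Definition _ :=
  GRing.isDivringClosed.Build E algebraic_pred algebraic_pred_divring.

Definition algebraic_elt := {x : E | x \in algebraic_pred}.

HB.instance Definition _ := SubChoice.on algebraic_elt.
HB.instance Definition _ := [SubChoice_isSubIntegralDomain of algebraic_elt by <:].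
HB.instance Definition _ := [SubIntegralDomain_isSubField of algebraic_elt by <:].

Definition algebraic_inj (a : F) : algebraic_elt :=
  exist _ (iota a) (asboolT (algebraic_id iota a)).

Lemma algebraic_inj_zmod : zmod_morphism algebraic_inj.
Proof. by move=> a b; apply: val_inj; rewrite /= rmorphB. Qed.
Lemma algebraic_inj_monoid : monoid_morphism algebraic_inj.
Proof. by split=> [|a b]; apply: val_inj; rewrite /= ?rmorph1 ?rmorphM. Qed.

HB.instance Definition _ :=
  GRing.isZmodMorphism.Build F algebraic_elt algebraic_inj algebraic_inj_zmod.
HB.instance Definition _ := GRing.isMonoidMorphism.Build F algebraic_elt
  algebraic_inj algebraic_inj_monoid.

(** A root [z], in an extension of [E], of a polynomial with algebraic
    coefficients is itself algebraic over [F]. It is thus a root of a polynomial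
    over [F]; the latter splits in [E] already, so [z] comes from [E]. *)
Lemma algebraic_elt_splits_all :
    (forall p, p \is monic -> splits_completely (map_poly iota p)) ->
  splits_all algebraic_elt.
Proof.
move=> Fsplit q q_monic.
have q'_monic : map_poly val q \is monic by exact: monic_map.
have [E' [jota [rs qrs]]] := split_extension q'_monic.
have [z zrs|es rses] := @seq_preimage algebraic_elt _ (jota \o val) rs.
  have [||f f_monic fz] := @integral_root_monic _ _ (jota \o iota) z _ (monic_map jota q'_monic).
  - by rewrite qrs root_prod_XsubC.
  - move=> _ /(nthP 0)[i _ <-]; rewrite !coef_map.
    by apply/integral_rmorph/integral_algebraic/asboolP; exact: (valP q`_i).
  have [es fes] := Fsplit f f_monic; move: fz.
  rewrite map_poly_comp fes map_poly_prod_XsubC root_prod_XsubC => /mapP[e ees ->].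
  have ae : e \in algebraic_pred.
    apply/asboolP; exists f; first exact: monic_neq0.
    by rewrite fes root_prod_XsubC.
  by exists (exist _ e ae).
exists es; apply: (@map_poly_inj _ _ (jota \o val)).
by rewrite map_poly_comp qrs rses map_poly_prod_XsubC.
Qed.

End AlgebraicElements.

Lemma algebraic_closure (F : fieldType) :
  exists (E : fieldType) (iota : {rmorphism F -> E}), splits_all E.
Proof.
have [E [iota sE]] := split_all_extension F.
by exists (algebraic_elt iota), (algebraic_inj iota); exact: algebraic_elt_splits_all.
Qed.

(** * Henselian finiteness rings *)

Section Henselian.
Variables (R : realType) (L : fieldType) (v : pseudo_absval R L).

(** Valuation rings are integrally closed: if 1/x belongs to the ring, dividing
    the equation of [x] by a power of [x] writes [x] as a polynomial in 1/x. *)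
Lemma integral_fin_pred (p : {poly finring v}) (x : L) :
  p \is monic -> root (map_poly val p) x -> x \in fin_pred v.
Proof.
move=> p_monic /rootP px; have [//|Vx] := orP (finring_valuation v x).
have [->|x0] := eqVneq x 0; first exact: rpred0.
have [n szp] : exists n, size p = n.+1.
  by exists (size p).-1; rewrite prednK// size_poly_gt0 monic_neq0.
have pn : p`_n = 1 by move/monicP: p_monic; rewrite lead_coefE szp.
pose f : {rmorphism finring v -> L} := val.
have {px} : \sum_(i < n) f p`_i * x ^+ i + x ^+ n = 0.
  rewrite -[RHS]px (@horner_coef_wide _ n.+1); last first.
    by rewrite (size_map_inj_poly val_inj (rmorph0 _)) szp.
  rewrite -[map_poly _ _]/(map_poly f p) [RHS]big_ord_recr; congr (_ + _).
    by apply: eq_bigr => i _; rewrite coef_map.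
  have fpn : (map_poly f p)`_n = 1 by rewrite coef_map pn; exact: rmorph1 f.
  by rewrite [X in _ = X * _]fpn mul1r.
case: n {szp pn} => [|n].
  by rewrite big_ord0 add0r expr0 => /eqP; rewrite oner_eq0.
move=> /eqP; rewrite addrC addr_eq0 => /eqP xn.
have -> : x = - \sum_(i < n.+1) f p`_i * x^-1 ^+ (n - i).
  apply: (mulIf (expf_neq0 n x0)); rewrite -exprS xn mulNr mulr_suml.
  congr (- _); apply: eq_bigr => i _; rewrite -mulrA; congr (_ * _).
  have lin : (i <= n)%N by rewrite -ltnS.
  have -> : x ^+ n = x ^+ (n - i) * x ^+ i by rewrite -exprD subnK.
  by rewrite mulrA -exprMn mulVf// expr1n mul1r.
rewrite rpredN rpred_sum// => i _; rewrite rpredM ?rpredX//; exact: valP.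
Qed.

(** The roots of a monic polynomial lie in the finiteness ring, so its factorization
    can be reduced: every root in the residue field, simple or not, lifts. *)
Lemma splits_all_henselian :
  splits_all L -> henselian (residue_map (v := v)).
Proof.
move=> Lsplit p p_monic a0 pa0 _.
have [rs prs] := Lsplit _ (monic_map val p_monic).
have [x xrs|ss rsE] := @seq_preimage (finring v) _ val rs.
  have fx : x \in fin_pred v.
    by apply: integral_fin_pred p_monic _; rewrite prs root_prod_XsubC.
  by exists (exist _ x fx).
have pE : p = \prod_(s <- ss) ('X - s%:P).
  apply: (map_inj_poly val_inj (rmorph0 _)).
  by rewrite prs rsE map_poly_prod_XsubC.
move: pa0; rewrite {1}pE map_poly_prod_XsubC root_prod_XsubC => /mapP[s sss ->].
exists s => //; rewrite pE (big_rem s)//= rootE hornerM hornerXsubC subrr.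
by rewrite mul0r.
Qed.

End Henselian.

(** * Ultraproducts of pseudo-absolute values *)

Section UltraproductNorm.
Variables (R : realType) (I : Type) (U : set_system I) (UU : UltraFilter U).
Variables (K : I -> fieldType) (v : forall i, pseudo_absval R (K i)).
Local Notation P := (family_prod K UU).
Local Notation E := (ultraprod UU K).
Local Notation class := (@up_class I U UU K).

(** The bound |x| <= r holds in the ultraproduct when it holds in almost all
    components. The dichotomy is then the ultrafilter property applied to the set
    of indices for which the bound holds. *)
Lemma ultraprod_pav : exists w : pseudo_absval R E,
  (forall (f : P) r, (w (class f) < r%:E)%E ->
    U [set i | (v i (f i) <= r%:E)%E]) /\
  (forall (f : P) r, U [set i | (v i (f i) <= r%:E)%E] ->
    (w (class f) <= r%:E)%E).
Proof.
pose S : set (E * R) := [set z | U [set i | (v i (repr z.1 i) <= z.2%:E)%E]].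
have SE (f : P) r : S (class f, r) <-> U [set i | (v i (f i) <= r%:E)%E].
  have Ufr : U [set i | f i = repr (class f) i].
    by apply/up_class_eq; rewrite up_class_repr.
  by split=> Uf; apply: filterS2 Ufr Uf => i /= ->.
have Sclass (z : E * R) : exists f r, z = (class f, r).
  by exists (repr z.1), z.2; rewrite up_class_repr; case: z.
have bS : bound_system S.
  split.
  - move=> r r0; rewrite -(rmorph0 class); apply/SE; apply: filterE => i /=.
    by rewrite pav0.
  - have -> : 1 = (class 1, 1) :> E * R by rewrite rmorph1.
    by apply/SE; apply: filterE => i /=; rewrite pav1.
  - rewrite -(rmorphN1 class); apply/SE; apply: filterE => i /=.
    by rewrite -[X in v i X]/(- 1) pavN1.
  - move=> y z; have [f [r ->]] := Sclass y; have [g [s ->]] := Sclass z.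
    move=> /SE Uf /SE Ug; rewrite -[S _]/(S (class f + class g, r + s)) -rmorphD.
    apply/SE; apply: filterS2 Uf Ug => i /= fr gs.
    by apply: le_trans (pavD _ _ _) _; rewrite EFinD leeD.
  - move=> y z; have [f [r ->]] := Sclass y; have [g [s ->]] := Sclass z.
    move=> /SE Uf /SE Ug; rewrite -[S _]/(S (class f * class g, r * s)) -rmorphM.
    apply/SE; apply: filterS2 Uf Ug => i /= fr gs.
    rewrite pavMfin ?EFinM ?lee_pmul ?pav_ge0//.
      exact: le_lt_trans fr (ltry _).
    exact: le_lt_trans gs (ltry _).
  - move=> z Sz; have [i iz] := filter_ex Sz; rewrite -lee_fin.
    exact: le_trans (pav_ge0 _ _) iz.
  - move=> r; rewrite -(rmorph1 class) => /SE U1; have [i] := filter_ex U1.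
    by rewrite /= pav1.
have dich x r : x != 0 -> 0 < r -> S (x, r) \/ S (x^-1, r^-1).
  move=> x0 r0.
  have [Sx|nSx] := in_ultra_setVsetC [set i | (v i (repr x i) <= r%:E)%E] UU.
    by left.
  have -> : x^-1 = class (fun i => (repr x i)^-1) by [].
  right; apply/SE; apply: filterS nSx => i /= /negP; rewrite -ltNge.
  exact: pavV_le.
have [w [wS Sw]] := pav_of_bounds bS dich.
by exists w; split=> f r h; [exact/SE/wS|exact/Sw/SE].
Qed.

End UltraproductNorm.

(** * Completeness of the residue field of an ultrapower *)

Section UltrapowerComplete.
Variables (R : realType) (U : set_system nat) (UU : UltraFilter U).
Hypothesis U_oo : \oo `<=` U.
Variables (L : fieldType) (v : pseudo_absval R L).

Lemma filter_forall_lt (T : Type) (F : set_system T) (A : nat -> set T) n :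
  Filter F -> (forall i, (i < n)%N -> F (A i)) ->
  F [set k | forall i, (i < n)%N -> A i k].
Proof.
move=> FF; elim: n => [|n IH] FA; first exact: filterE.
have FAn := IH (fun i (ni : (i < n)%N) => FA i (ltnW ni)).
apply: filterS2 FAn (FA n (leqnn _)) => k Ak Ank i.
by rewrite ltnS leq_eqVlt => /predU1P[->//|]; exact: Ak.
Qed.

(** Diagonal argument: [l k] satisfies the longest initial segment of the
    conditions of index at most [k] that can be satisfied at [k]. *)
Lemma countable_saturation (T : Type) (Q : nat -> nat -> T -> Prop) :
  (forall j, U [set k | exists x, forall i, (i <= j)%N -> Q i k x]) ->
  exists l : nat -> T, forall i, U [set k | Q i k (l k)].
Proof.
move=> UQ; have [_ [x0 _]] := filter_ex (UQ 0%N).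
have pick b k : exists x, forall j, (j < b)%N ->
    (exists y, forall i, (i <= j)%N -> Q i k y) ->
    forall i, (i <= j)%N -> Q i k x.
  elim: b => [|b [x xP]]; first by exists x0.
  have [[y yP]|ny] := pselect (exists y, forall i, (i <= b)%N -> Q i k y).
    by exists y => j jb _ i ij; apply: yP; exact: leq_trans ij jb.
  exists x => j; rewrite ltnS leq_eqVlt => /predU1P[->|]; first by [].
  exact: xP.
have [l lP'] := choice (fun k => pick k.+1 k).
have lP k j : (j <= k)%N -> (exists y, forall i, (i <= j)%N -> Q i k y) ->
    Q j k (l k) by move=> jk yP; apply: (lP' k j).
exists l => i; have Ui : U [set k | (i <= k)%N] by apply: U_oo; exists i.
by apply: filterS2 Ui (UQ i) => k /= ik; exact: lP.
Qed.

Local Notation P := (family_prod (fun _ : nat => L) UU).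
Local Notation E := (ultraprod UU (fun _ : nat => L)).
Local Notation class := (@up_class nat U UU (fun _ => L)).

(** A limit of a Cauchy sequence is an element within 1/(i+1) of its [M i]-th term
    for every [i]. Finitely many of these conditions are met in almost all
    components by a later term of the sequence, so saturation applies. *)
Lemma ultrapower_residue_complete (w : pseudo_absval R E) :
    (forall (f : P) r, (w (class f) < r%:E)%E -> U [set k | (v (f k) <= r%:E)%E]) ->
    (forall (f : P) r, U [set k | (v (f k) <= r%:E)%E] -> (w (class f) <= r%:E)%E) ->
  av_complete (residue_absval w).
Proof.
move=> wU Uw u cauchy_u.
pose e i : R := i.+1%:R^-1.
have e0 i : 0 < e i by rewrite invr_gt0 ltr0n.
pose a n : finring w := repr (u n).
have av_sub x y : residue_absval w (residue_map x - residue_map y) =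
    fine (w (val (x - y))).
  by rewrite -rmorphB [LHS]residue_avE.
pose f n : P := repr (val (a n)).
have fE n : class (f n) = val (a n) by exact: up_class_repr.
have [M MP] := choice (fun i => cauchy_u (e i) (e0 i)).
have closeU i m n : (M i <= m)%N -> (M i <= n)%N ->
    U [set k | (v (f m k - f n k)%R <= (e i)%:E)%E].
  move=> im jn; apply: (wU (f m - f n)).
  have -> : class (f m - f n) = val (a m - a n).
    exact: etrans (rmorphB class _ _) (congr2 (fun x y => x - y) (fE m) (fE n)).
  rewrite -finring_fineK lte_fin.
  by have := MP i m n im jn; rewrite -[u m]residue_map_repr -[u n]residue_map_repr av_sub.
have [l lP] : exists l : P, forall i, U [set k | (v (f (M i) k - l k)%R <= (e i)%:E)%E].
  apply: (countable_saturation (Q := fun i k x => (v (f (M i) k - x)%R <= (e i)%:E)%E)) => j.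
  pose N := \max_(i < j.+1) M i.
  have UN : U [set k | forall i, (i < j.+1)%N -> (v (f (M i) k - f N k)%R <= (e i)%:E)%E].
    apply: filter_forall_lt => i ij; apply: closeU => //.
    exact: (leq_bigmax (Ordinal ij)).
  by apply: filterS UN => k kP; exists (f N k) => i ij; exact: kP.
have wl i : (w (val (a (M i)) - class l)%R <= (e i)%:E)%E.
  by rewrite -fE -[X in w X](rmorphB class); apply: Uw; exact: lP.
have fin_l : class l \in fin_pred w.
  rewrite -[class l](subKr (val (a (M 0%N)))) rpredB//; first exact: valP.
  by rewrite unfold_in /fin_pred; apply: le_lt_trans (wl 0%N) (ltry _).
pose b : finring w := exist _ (class l) fin_l.
exists (residue_map b); apply/cvgrPdist_lt => d d0.
have [i id] : exists i, 2 * e i < d.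
  have d2 : 0 < d / 2 by rewrite divr_gt0.
  have [i _ /(_ i (leqnn i))] := near_infty_natSinv_lt (PosNum d2).
  by rewrite /= ltr_pdivlMr// mulrC; exists i.
exists (M i) => // n /= Mn; rewrite sub0r normrN ger0_norm ?residue_av_ge0//.
apply: le_lt_trans id; rewrite -[u n - _](subrKA (u (M i))).
apply: le_trans (residue_avD _ _) _; rewrite mulr_natl mulr2n lerD//.
  by apply/ltW/MP.
rewrite -[u (M i)]residue_map_repr [leLHS]av_sub -lee_fin finring_fineK.
exact: wl.
Qed.

End UltrapowerComplete.

(** * Existence of a complete extension *)

Theorem proposition5p2p4 (R : realType) (K : fieldType)
    (v : pseudo_absval R K) :
  exists (Khat : fieldType) (iota : {rmorphism K -> Khat})
    (vhat : pseudo_absval R Khat),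
    pav_extends iota v vhat /\ pav_complete vhat.
Proof.
have [L [iota Lsplit]] := algebraic_closure K.
have [w wv] := pav_extension iota v.
have [U [UU U_oo]] := ultraFilterLemma (@eventually_filter).
have [vhat [vU Uv]] := ultraprod_pav UU (fun _ => w).
pose diag := up_diag UU (fun _ : nat => idfun : {rmorphism L -> L}).
exists (ultraprod UU (fun _ => L)), (diag \o iota), vhat; split; last split.
- move=> a; rewrite -(wv a).
  apply: ereal_eq_bounds; rewrite ?pav_ge0// => r.
    by move=> /vU Ur; have [] := filter_ex Ur.
  by move=> wr; apply: Uv; exact: filterE.
- by apply: splits_all_henselian; apply: ultraprod_splits_all => _.
- exact: ultrapower_residue_complete vU Uv.
Qed.
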